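(* Let $R$ be the $R$-matrix defined in the context, with parameters $a_i,b_i,c_i,d_i,e_i$ ($i=1,2,3$, $a_i+b_i+c_i+d_i+e_i=0$) and canonical variables $\mathsf{u}_i,\mathsf{w}_i$ attached to the tensor components $4,5,6$ for $i=1,2,3$ respectively. Under the identification $$X_i=\mathrm{e}^{\mathsf{u}_i},\quad Z_i=\mathrm{e}^{-\mathsf{w}_i},\quad r_i=\mathrm{e}^{c_i},\quad s_i=\mathrm{e}^{a_i},\quad t_i=\mathrm{e}^{-b_i},\quad w_i=\mathrm{e}^{-d_i}\qquad(i=1,2,3),$$ the relation $$\mathscr{R}_{456}\,\mathscr{L}^p_{236}\,\mathscr{L}^p_{135}\,\mathscr{L}^p_{124}=\mathscr{L}^p_{124}\,\mathscr{L}^p_{135}\,\mathscr{L}^p_{236}\,\mathscr{R}_{456}$$ with $p=q$ holds for $\mathscr{R}=R$, where $\mathscr{L}^p_{124},\mathscr{L}^p_{135},\mathscr{L}^p_{236}$ carry the parameters $(r_1,s_1,t_1,w_1)$, $(r_2,s_2,t_2,w_2)$, $(r_3,s_3,t_3,w_3)$ respectively on both sides.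
   Context: $q=\mathrm{e}^\hbar$ generic. $[\mathsf{u}_i,\mathsf{w}_j]=\hbar\delta_{ij}$, $[\mathsf{u}_i,\mathsf{u}_j]=[\mathsf{w}_i,\mathsf{w}_j]=0$. $\Psi_q(Y)=1/(-qY;q^2)_\infty$, $(z;q)_\infty=\prod_{n\ge0}(1-zq^n)$. $L$-operator: $V=\mathbb{C}v_0\oplus\mathbb{C}v_1$, $E_{ij}v_k=\delta_{jk}v_i$; $\mathcal{W}(p)$ is the algebra generated by $Z^{\pm1},X^{\pm1}$ with $ZX=pXZ$. For parameters $(r,s,t,w)$, $$\mathscr{L}^p=\sum_{a,b,i,j\in\{0,1\}}E_{ai}\otimes E_{bj}\otimes\mathscr{L}^{ab}_{ij}\in\mathrm{End}(V\otimes V)\otimes\mathcal{W}(p),$$ with $\mathscr{L}^{ab}_{ij}=0$ unless $a+b=i+j$, and $\mathscr{L}^{00}_{00}=r$, $\mathscr{L}^{11}_{11}=s$, $\mathscr{L}^{10}_{10}=wX$, $\mathscr{L}^{01}_{01}=tX$, $\mathscr{L}^{10}_{01}=Z$, $\mathscr{L}^{01}_{10}=rsZ^{-1}+tw\,XZ^{-1}X$. (The parameter $w_i$ is not the canonical variable $\mathsf{w}_i$.) In $\mathscr{L}^p_{236}$ etc. the subscripts denote the tensor components of $V_1\otimes V_2\otimes V_3\otimes\mathcal{W}_4\otimes\mathcal{W}_5\otimes\mathcal{W}_6$ where the operator acts; $X_1,Z_1$ (resp. $X_2,Z_2$; $X_3,Z_3$) are the generators in component 4 (resp. 5; 6). Componentwise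 the relation reads, for all $a,b,c,i,j,k\in\{0,1\}$, $$\mathscr{R}\sum_{\alpha,\beta,\gamma}\bigl(\mathscr{L}^{\alpha\beta}_{ij}\otimes\mathscr{L}^{a\gamma}_{\alpha k}\otimes\mathscr{L}^{bc}_{\beta\gamma}\bigr)=\sum_{\alpha,\beta,\gamma}\bigl(\mathscr{L}^{ab}_{\alpha\beta}\otimes\mathscr{L}^{\alpha c}_{i\gamma}\otimes\mathscr{L}^{\beta\gamma}_{jk}\bigr)\mathscr{R}.$$ $R$-matrix: $$R=\Psi_q(\mathrm{e}^{-d_1-c_2-b_3+\mathsf{u}_1+\mathsf{u}_3+\mathsf{w}_1-\mathsf{w}_2+\mathsf{w}_3})^{-1}\Psi_q(\mathrm{e}^{-d_1-c_2-b_3-e_3+\mathsf{u}_1-\mathsf{u}_3+\mathsf{w}_1-\mathsf{w}_2+\mathsf{w}_3})^{-1}$$ $$\times P\,\Psi_q(\mathrm{e}^{-b_1-a_2-d_3-e_3+\mathsf{u}_1-\mathsf{u}_3+\mathsf{w}_1-\mathsf{w}_2+\mathsf{w}_3})\Psi_q(\mathrm{e}^{-b_1-a_2-d_3+\mathsf{u}_1+\mathsf{u}_3+\mathsf{w}_1-\mathsf{w}_2+\mathsf{w}_3}),$$ $$P=\mathrm{e}^{\frac1\hbar(\mathsf{u}_3-\mathsf{u}_2)\mathsf{w}_1}\mathrm{e}^{\frac{\lambda_0}{\hbar}(-\mathsf{w}_1-\mathsf{w}_2+\mathsf{w}_3)}\mathrm{e}^{\frac1\hbar(\lambda_1\mathsf{u}_1+\lambda_2\mathsf{u}_2+\lambda_3\mathsf{u}_3)}\rho_{23},$$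 $\lambda_0=\frac{e_2-e_3}2$, $\lambda_1=a_2-a_3+b_2-b_3+\lambda_0$, $\lambda_2=-a_1-b_2+b_3-\lambda_0$, $\lambda_3=c_1-c_2+c_3$; $\rho_{23}$ exchanges $(\mathsf{u}_2,\mathsf{w}_2)\leftrightarrow(\mathsf{u}_3,\mathsf{w}_3)$ and acts trivially on parameters. A relation $RF=GR$ between elements $F,G$ of the $q$-Weyl algebra means $\mathrm{Ad}(R)(F)=RFR^{-1}=G$ in the non-commuting fraction field of the algebra generated by $\mathrm{e}^{\pm\mathsf{u}_i},\mathrm{e}^{\pm\mathsf{w}_i}$, the adjoint action of $\Psi_q$ being determined by $\Psi_q(q^2U)\Psi_q(U)^{-1}=1+qU$ and that of the exponential factors by the Baker–Campbell–Hausdorff formula. *)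

(* Defs.v *)
From HB Require Import structures.
From mathcomp Require Import all_boot all_order all_algebra.
From mathcomp Require Import complex mxtens.
From mathcomp Require Import all_classical all_reals all_analysis.
Set Implicit Arguments.
Unset Strict Implicit.
Unset Printing Implicit Defensive.
Import Order.TTheory GRing.Theory Num.Theory.
Local Open Scope ring_scope.

Definition i1 : 'I_3 := @Ordinal 3 0 isT.
Definition i2 : 'I_3 := @Ordinal 3 1 isT.
Definition i3 : 'I_3 := @Ordinal 3 2 isT.

Definition cexp (R : realType) (z : R[i]) : R[i] :=
  Complex (expR (complex.Re z) * cos (complex.Im z))
          (expR (complex.Re z) * sin (complex.Im z)).

(** ** Degree <= 1 elements of the canonical variables

    [(k, (m, n))] stands for [k + \sum_i m_i u_i + \sum_i n_i w_i], where
    [[u_i, w_j] = hbar delta_ij]. *)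

Notation lform R := (R[i] * ('rV[int]_3 * 'rV[int]_3))%type.

Section LinearForms.
Variable R : realType.
Implicit Types f g h : lform R.

Definition lconst (k : R[i]) : lform R := (k, (0, 0)).
Definition lu (i : 'I_3) : lform R := (0, (delta_mx 0 i, 0)).
Definition lw (i : 'I_3) : lform R := (0, (0, delta_mx 0 i)).

(** [[f, h] = hbar * lbr f h] *)
Definition lbr f h : int :=
  \sum_(i < 3) (f.2.1 0 i * h.2.2 0 i - f.2.2 0 i * h.2.1 0 i).

(** Adjoint action of [exp ((1/hbar) \sum_k lam_k f_k)] for
    [s = [:: (lam_0, f_0); (lam_1, f_1); ...]].  The bracket with the exponent
    is a scalar, so [exp(ad)(h) = h + ad(h)]. *)
Definition Ad_exp_lin (s : seq (R[i] * lform R)) h : lform R :=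
  h + lconst (\sum_(x <- s) x.1 * (lbr x.2 h)%:~R).

(** Adjoint action of [exp ((1/hbar) f g)] when [[f, g] = 0].  By Leibniz
    [[f g, h] = f [g, h] + [f, h] g], and applying the bracket twice gives 0,
    so again [exp(ad)(h) = h + ad(h)]. *)
Definition Ad_exp_quad f g h : lform R :=
  h + (f *~ lbr g h + g *~ lbr f h).

Definition Ad_rho23 h : lform R := (h.1, (xcol i2 i3 h.2.1, xcol i2 i3 h.2.2)).

End LinearForms.

(** ** The q-Weyl algebra and its skew field of fractions

    [eu i] and [ew i] play the role of [e^(u_i)] and [e^(w_i)]. *)

Section QWeyl.
Variables (R : realType) (hbar : R[i]) (D : unitAlgType R[i]).
Variables (eu ew : 'I_3 -> D).

Definition qparam : R[i] := cexp hbar.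

Definition qmono (v : 'rV[int]_3 * 'rV[int]_3) : D :=
  (\prod_(i < 3) eu i ^ (v.1 0 i)) * (\prod_(i < 3) ew i ^ (v.2 0 i)).

Definition in_qWeyl (x : D) : Prop :=
  exists (s : seq ('rV[int]_3 * 'rV[int]_3))
         (k : 'rV[int]_3 * 'rV[int]_3 -> R[i]),
    x = \sum_(v <- s) k v *: qmono v.

(** [D] is the skew field of fractions of the algebra generated by
    [e^(+-u_i)], [e^(+-w_i)]: it is a division algebra, the relations
    [e^(u_i) e^(w_j) = q^(delta_ij) e^(w_j) e^(u_i)] hold, ordered monomials are
    linearly independent (so the subalgebra [in_qWeyl] is the q-Weyl algebra
    itself and not a proper quotient), and every element is a fraction of
    elements of that subalgebra.  As the q-Weyl algebra is a Noetherian, hence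
    Ore, domain, such a [D] exists and is unique up to isomorphism. *)
Record is_qWeyl_fraction_field : Prop := QWeylFractionField {
  qW_division : forall x : D, x != 0 -> x \is a GRing.unit;
  qW_unit_u : forall i, eu i \is a GRing.unit;
  qW_unit_w : forall i, ew i \is a GRing.unit;
  qW_uu : forall i j, eu i * eu j = eu j * eu i;
  qW_ww : forall i j, ew i * ew j = ew j * ew i;
  qW_uw : forall i j,
    eu i * ew j = (if i == j then qparam else 1) *: (ew j * eu i);
  qW_free : forall (s : seq ('rV[int]_3 * 'rV[int]_3))
                   (k : 'rV[int]_3 * 'rV[int]_3 -> R[i]),
    uniq s -> \sum_(v <- s) k v *: qmono v = 0 ->
    forall v, v \in s -> k v = 0;
  qW_frac : forall x : D, exists y z : D,
    [/\ in_qWeyl y, in_qWeyl z, z != 0 & x = y / z] }.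

(** [e^(k + m.u + n.w) = e^k e^(- [m.u, n.w] / 2) e^(m.u) e^(n.w)] with
    [[m.u, n.w] = hbar \sum_i m_i n_i]. *)
Definition lexp (h : lform R) : D :=
  cexp (h.1 - hbar / 2%:R * (\sum_(i < 3) h.2.1 0 i * h.2.2 0 i)%:~R)
    *: qmono h.2.

(** The graph of the algebra homomorphism determined by the prescribed values
    [base] and defined on the division subalgebra of [D] generated by the domain
    of [base], for values which do extend to such a homomorphism. *)
Inductive hom_graph (base : D -> D -> Prop) : D -> D -> Prop :=
| hom_base x y : base x y -> hom_graph base x y
| hom_scalar (k : R[i]) : hom_graph base k%:A k%:A
| hom_add x y x' y' : hom_graph base x x' -> hom_graph base y y' ->
    hom_graph base (x + y) (x' + y')
| hom_mul x y x' y' : hom_graph base x x' -> hom_graph base y y' ->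
    hom_graph base (x * y) (x' * y')
| hom_inv x x' : x \is a GRing.unit -> hom_graph base x x' ->
    hom_graph base x^-1 x'^-1.

(** [Ad_Psi u x y] means [Psi_q(u) x Psi_q(u)^-1 = y].  If [u] and [x] commute
    then so do [Psi_q(u)] and [x]; if [u x = q^2 x u] then
    [Psi_q(u) x = x Psi_q(q^2 u)], whence
    [Psi_q(u) x Psi_q(u)^-1 = x Psi_q(q^2 u) Psi_q(u)^-1 = x (1 + q u)].
    For [u = e^f] this determines the action on every [e^h] with [lbr f h]
    even.  For [lbr f h] odd, [Psi_q(u) e^h Psi_q(u)^-1] is not in the fraction
    field, so the relation is only partially defined.  It is single-valued when
    [u] is a [lexp]: expand the elements of [D] in Malcev-Neumann series for an
    order on the exponents with [f > 0]; then [Psi_q(u)] is itself such a series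
    (as [q] is not a root of unity), and [Ad_Psi u] is contained in the graph of
    conjugation by it. *)
Definition Ad_Psi (u : D) : D -> D -> Prop :=
  hom_graph (fun x y =>
    (u * x = x * u /\ y = x) \/
    (u * x = qparam ^+ 2 *: (x * u) /\ y = x * (1 + qparam *: u))).

(** Action on [D] of an invertible operator whose adjoint action on the linear
    forms is [sigma]. *)
Definition Ad_lift (sigma : lform R -> lform R) : D -> D -> Prop :=
  hom_graph (fun x y => exists h, x = lexp h /\ y = lexp (sigma h)).

Section RMatrix.
Variables (a b c d e : 'I_3 -> R[i]).

Let lam0 : R[i] := (e i2 - e i3) / 2%:R.
Let lam1 : R[i] := a i2 - a i3 + b i2 - b i3 + lam0.
Let lam2 : R[i] := - a i1 - b i2 + b i3 - lam0.
Let lam3 : R[i] := c i1 - c i2 + c i3.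

Definition Ad_P_lform (h : lform R) : lform R :=
  Ad_exp_quad (lu R i3 - lu R i2) (lw R i1)
    (Ad_exp_lin [:: (lam0, - lw R i1 - lw R i2 + lw R i3)]
      (Ad_exp_lin [:: (lam1, lu R i1); (lam2, lu R i2); (lam3, lu R i3)]
        (Ad_rho23 h))).

Let yp : lform R := lu R i1 + lu R i3 + lw R i1 - lw R i2 + lw R i3.
Let ym : lform R := lu R i1 - lu R i3 + lw R i1 - lw R i2 + lw R i3.

Definition Y1 : D := lexp (lconst (- d i1 - c i2 - b i3) + yp).
Definition Y2 : D := lexp (lconst (- d i1 - c i2 - b i3 - e i3) + ym).
Definition Y3 : D := lexp (lconst (- b i1 - a i2 - d i3 - e i3) + ym).
Definition Y4 : D := lexp (lconst (- b i1 - a i2 - d i3) + yp).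

(** [Ad_R x y] means [R x R^-1 = y] for
    [R = Psi(Y1)^-1 Psi(Y2)^-1 P Psi(Y3) Psi(Y4)].  The adjoint action of
    [Psi(Y)^-1] is the relation converse to [Ad_Psi Y]. *)
Definition Ad_R (x y : D) : Prop :=
  exists x4 x3 xP x2 : D,
    [/\ Ad_Psi Y4 x x4, Ad_Psi Y3 x4 x3, Ad_lift Ad_P_lform x3 xP,
        Ad_Psi Y2 x2 xP & Ad_Psi Y1 y x2].

End RMatrix.
End QWeyl.

(** ** The L-operator *)

Section LOperator.
Variables (K : comNzRingType) (A : unitAlgType K).

(** [Lent r s t w X Z a b i j] is [L^{ab}_{ij}]. *)
Definition Lent (r s t w : K) (X Z : A) (a b i j : 'I_2) : A :=
  match val a, val b, val i, val j with
  | 0%N, 0%N, 0%N, 0%N => r%:A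
  | 1%N, 1%N, 1%N, 1%N => s%:A
  | 1%N, 0%N, 1%N, 0%N => w *: X
  | 0%N, 1%N, 0%N, 1%N => t *: X
  | 1%N, 0%N, 0%N, 1%N => Z
  | 0%N, 1%N, 1%N, 0%N => (r * s) *: Z^-1 + (t * w) *: (X * Z^-1 * X)
  | _, _, _, _ => 0
  end.

(** The operators on [V1 * V2 * V3] with coefficients in [A] obtained from the
    entries [L] by acting on the factors (1,2), (1,3), (2,3) of [V].  The matrix
    [delta_mx a i] is [E_{ai}]. *)
Implicit Types L : 'I_2 -> 'I_2 -> 'I_2 -> 'I_2 -> A.

Definition L12 L : 'M[A]_(2 * 2 * 2) :=
  \sum_a \sum_b \sum_i \sum_j
    L a b i j *: ((delta_mx a i *t delta_mx b j) *t 1%:M).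
Definition L13 L : 'M[A]_(2 * 2 * 2) :=
  \sum_a \sum_b \sum_i \sum_j
    L a b i j *: ((delta_mx a i *t 1%:M) *t delta_mx b j).
Definition L23 L : 'M[A]_(2 * 2 * 2) :=
  \sum_a \sum_b \sum_i \sum_j
    L a b i j *: ((1%:M *t delta_mx a i) *t delta_mx b j).

End LOperator.

(* Main.v *)
(* Write E(h) for the exponential of a linear form h.  With f, h such that
   [f, h] = hbar n, the action of Psi_q(E(f)) is
     E(h) |-> E(h)               if n = 0,
     E(h) |-> E(h) + E(h + f)    if n = 2,
     E(h) + E(h + f) |-> E(h)    if n = -2,
   the last rule being the second one for -h, inverted.  Every entry of either
   product of L-operators is a sum of E(h)'s with coefficient 1.  Moving the two
   leftmost factors of R to the other side, one has to see that the entries of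
   the left-hand side transformed by Psi(Y4), Psi(Y3), P agree with those of the
   right-hand side transformed by Psi(Y1), Psi(Y2).  At every stage the terms
   with n = -2 group into pairs E(h) + E(h + f), so no denominators ever occur
   and both sides stay sums of exponentials; comparing them is a finite
   computation with the integer coordinates of the forms h. *)
Require Import Defs.
From HB Require Import structures.
From mathcomp Require Import all_boot all_order all_algebra.
From mathcomp Require Import complex mxtens.
From mathcomp Require Import all_classical all_reals all_analysis.
From mathcomp Require Import perm ring.
Set Implicit Arguments.
Unset Strict Implicit.
Unset Printing Implicit Defensive.
Import Order.TTheory GRing.Theory Num.Theory.
Local Open Scope ring_scope.

(** * The complex exponential as a homomorphism *)

Section ComplexExponential.
Variable R : realType.
Implicit Types z w : R[i].

Lemma cexpD z w : cexp (z + w) = cexp z * cexp w.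
Proof.
case: z w => [x y] [x' y']; apply/eqP; rewrite eq_complex /= expRD cosD sinD.
by apply/andP; split; apply/eqP; ring.
Qed.

Lemma cexp0 : cexp 0 = 1 :> R[i].
Proof. by apply/eqP; rewrite eq_complex /= expR0 cos0 sin0 mulr1 mulr0 !eqxx. Qed.

Lemma cexp_neq0 z : cexp z != 0.
Proof.
apply/eqP => z0; move: (cexpD z (- z)).
by rewrite z0 mul0r subrr cexp0 => /eqP; rewrite oner_eq0.
Qed.

Lemma cexpN z : cexp (- z) = (cexp z)^-1.
Proof.
apply: (mulfI (cexp_neq0 z)).
by rewrite -cexpD subrr cexp0 divff ?cexp_neq0.
Qed.

Lemma cexp_mulrz z (n : int) : cexp (z * n%:~R) = cexp z ^ n.
Proof.
have nat_case (m : nat) : cexp (z * m%:R) = cexp z ^+ m.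
  elim: m => [|m IHm]; first by rewrite mulr0 cexp0.
  by rewrite exprS -IHm -cexpD; congr cexp; rewrite -natr1; ring.
case: (intP n) => [|m|m]; first by rewrite mulr0 cexp0.
  exact: nat_case.
by rewrite rmorphN mulrN cexpN nat_case exprnN.
Qed.

End ComplexExponential.

(** * Commutation up to a scalar factor *)

Section QCommutation.
Variables (K : fieldType) (A : unitAlgType K).
Implicit Types (k l : K) (x y z : A).

Definition qcomm k x y : Prop := x * y = k *: (y * x).

Lemma qcomm_sym k x y : k != 0 -> qcomm k x y -> qcomm k^-1 y x.
Proof. by move=> k0 xy; rewrite /qcomm xy scalerA mulVf // scale1r. Qed.

Lemma qcommM k l x y z :
  qcomm k x y -> qcomm l x z -> qcomm (k * l) x (y * z).
Proof.
rewrite /qcomm => xy xz.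
by rewrite mulrA xy -scalerAl -[y * x * z]mulrA xz -scalerAr scalerA mulrA.
Qed.

Lemma qcomm_prod (I : Type) (r : seq I) (k : I -> K) x (F : I -> A) :
  (forall i, qcomm (k i) x (F i)) ->
  qcomm (\prod_(i <- r) k i) x (\prod_(i <- r) F i).
Proof.
move=> xF; elim: r => [|i r IHr]; last by rewrite !big_cons; exact: qcommM.
by rewrite /qcomm !big_nil mulr1 mul1r scale1r.
Qed.

Lemma qcommXz k x y (n : int) :
  y \is a GRing.unit -> k != 0 -> qcomm k x y -> qcomm (k ^ n) x (y ^ n).
Proof.
move=> uy k0 xy.
have nat_case (m : nat) : qcomm (k ^+ m) x (y ^+ m).
  elim: m => [|m IHm]; first by rewrite /qcomm mulr1 mul1r scale1r.
  by rewrite !exprS; exact: qcommM.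
case: (intP n) => [|m|m]; [exact: (nat_case 0%N) | exact: nat_case |].
have := nat_case m.+1; rewrite -!exprnN /qcomm => h.
have uym := unitrX m.+1 uy.
(* Multiplying by [y ^+ m.+1] on both sides turns the claim for the negative power into the positive
   case [h]. *)
apply: (mulrI uym); apply: (mulIr uym).
rewrite -scalerAr -scalerAl !mulrA divrr // mul1r h.
by rewrite mulrVK // scalerA mulVf ?scale1r // expf_neq0.
Qed.

Lemma qcomm_prodl (I : Type) (r : seq I) (k : I -> K) (F : I -> A) y :
  (forall i, k i != 0) -> (forall i, qcomm (k i) (F i) y) ->
  qcomm (\prod_(i <- r) k i) (\prod_(i <- r) F i) y.
Proof.
move=> k0 Fy; rewrite -[\prod_(i <- r) k i]invrK -prodfV.
apply: qcomm_sym; last by apply: qcomm_prod => i; exact: qcomm_sym.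
by elim/big_rec: _ => [|i z _ z0]; rewrite ?oner_neq0 ?mulf_neq0 ?invr_eq0.
Qed.

Lemma qcommXzl k x y (n : int) :
  x \is a GRing.unit -> k != 0 -> qcomm k x y -> qcomm (k ^ n) (x ^ n) y.
Proof.
move=> ux k0 xy.
have -> : k ^ n = ((k^-1) ^ n)^-1 by rewrite exprz_inv invr_expz opprK.
apply: qcomm_sym; first by rewrite expfz_neq0 ?invr_eq0.
by apply: qcommXz; rewrite ?invr_eq0 //; exact: qcomm_sym.
Qed.

End QCommutation.

(** * Exponentials of linear forms in the q-Weyl algebra *)

Section WeylExponentials.
Variables (R : realType) (hbar : R[i]) (D : unitAlgType R[i]).
Variables (eu ew : 'I_3 -> D).
Hypothesis hD : is_qWeyl_fraction_field hbar eu ew.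

Let q := qparam hbar.
Let E := lexp hbar eu ew.
Implicit Types f g h : lform R.

Let q_neq0 : q != 0. Proof. exact: cexp_neq0. Qed.

(** Only pairs of equal index contribute a power of [q]. The total is the cost of normal ordering a
    product of two monomials. *)
Lemma qcomm_wu_prod (m n : 'rV[int]_3) :
  qcomm (q ^ (- \sum_i n 0 i * m 0 i))
    (\prod_(i < 3) ew i ^ n 0 i) (\prod_(i < 3) eu i ^ m 0 i).
Proof.
have wu j i : qcomm (if i == j then q ^ (- (n 0 j * m 0 j)) else 1)
    (ew j ^ n 0 j) (eu i ^ m 0 i).
  set k : R[i] := if i == j then q^-1 else 1.
  have k0 : k != 0 by rewrite /k; case: ifP; rewrite ?invr_eq0 ?oner_neq0.
  have wuk : qcomm k (ew j) (eu i).
    have := qcomm_sym _ (qW_uw hD i j); rewrite /k.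
    by case: ifP => _; rewrite ?invr1; apply; rewrite ?oner_neq0.
  have := qcommXzl (n 0 j) (qW_unit_w hD j) (expfz_neq0 (m 0 i) k0)
    (qcommXz (m 0 i) (qW_unit_u hD i) k0 wuk).
  by rewrite exprz_exp /k; case: eqP => [->|_];
    rewrite ?exp1rz // exprz_inv mulrC.
rewrite -sumrN.
have -> : q ^ (\sum_i - (n 0 i * m 0 i)) = \prod_(i < 3) q ^ (- (n 0 i * m 0 i)).
  by elim/big_rec2: _ => [|i x y _ <-]; rewrite ?expr0z // expfzDr.
apply: qcomm_prodl => [j|j]; first by rewrite expfz_neq0.
have := qcomm_prod (index_enum 'I_3) (wu j).
by rewrite -big_mkcond big_pred1_eq.
Qed.

Lemma prod_exprzD (F : 'I_3 -> D) (m n : 'rV[int]_3) :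
  (forall i, F i \is a GRing.unit) -> (forall i j, F i * F j = F j * F i) ->
  \prod_i F i ^ (m + n) 0 i = (\prod_i F i ^ m 0 i) * \prod_i F i ^ n 0 i.
Proof.
move=> uF cF; rewrite -prodrM_comm => [|i j _ _].
  by apply: eq_bigr => i _; rewrite mxE exprzDr.
exact/commrXz/commr_sym/commrXz.
Qed.

Lemma qmonoM (v w : 'rV[int]_3 * 'rV[int]_3) :
  qmono eu ew v * qmono eu ew w =
  q ^ (- \sum_i v.2 0 i * w.1 0 i) *: qmono eu ew (v + w).
Proof.
rewrite /qmono /= !prod_exprzD; first last.
- exact: qW_uu hD.
- exact: qW_unit_u hD.
- exact: qW_ww hD.
- exact: qW_unit_w hD.
rewrite mulrA -[_ * _ * (\prod_i eu i ^ _)]mulrA qcomm_wu_prod.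
by rewrite -scalerAr -scalerAl !mulrA.
Qed.

(** Baker-Campbell-Hausdorff formula. For f = m.u + n.w and h = m'.u + n'.w, normal ordering gives -
    hbar n.m' and the prefactors of [lexp] differ by hbar/2 (m.n' + n.m'), which leaves half the
    commutator. *)
Lemma lexpM f h :
  E f * E h = E (f + h + lconst (hbar / 2%:R * (lbr f h)%:~R)).
Proof.
set k := hbar / 2%:R * (lbr f h)%:~R.
have e2 : (f + h + lconst k).2 = f.2 + h.2 by rewrite -[RHS]addr0.
have e1 : (f + h + lconst k).1 = f.1 + h.1 + k by [].
rewrite /E /lexp e1 e2 -scalerAl -scalerAr !scalerA qmonoM scalerA.
rewrite /q /qparam -cexp_mulrz -!cexpD; congr (cexp _ *: _).
rewrite /k /lbr big_split sumrN /=.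
have -> : \sum_(i < 3) (f.2.1 + h.2.1) 0 i * (f.2.2 + h.2.2) 0 i =
  \sum_(i < 3) f.2.1 0 i * h.2.2 0 i + \sum_(i < 3) f.2.2 0 i * h.2.1 0 i
  + \sum_(i < 3) f.2.1 0 i * f.2.2 0 i + \sum_(i < 3) h.2.1 0 i * h.2.2 0 i.
  by rewrite -!big_split /=; apply: eq_bigr => i _; rewrite !mxE; ring.
by field.
Qed.

Lemma lexp0 : E 0 = 1.
Proof.
by rewrite /E /lexp /qmono !big1 ?mulr0 ?subr0 ?cexp0 ?scale1r ?mulr1 // => i _;
  rewrite !mxE ?mulr0 ?expr0z.
Qed.

Lemma lexpDconst h (k : R[i]) : E (h + lconst k) = cexp k *: E h.
Proof.
rewrite /E /lexp scalerA -cexpD.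
have -> : (h + lconst k).2 = h.2 by rewrite -[RHS]addr0.
by rewrite /= addrCA addrA.
Qed.

Lemma lexp_const (k : R[i]) : E (lconst k) = (cexp k)%:A.
Proof. by rewrite -[lconst k]add0r lexpDconst lexp0. Qed.

Lemma lbrN f h : lbr f (- h) = - lbr f h.
Proof. by rewrite /lbr -sumrN; apply: eq_bigr => i _; rewrite !mxE; ring. Qed.

Lemma lbr_self f : lbr f f = 0.
Proof. by rewrite /lbr big1 // => i _; rewrite mulrC subrr. Qed.

Lemma lbrC f h : lbr f h = - lbr h f.
Proof. by rewrite /lbr -sumrN; apply: eq_bigr => i _; ring. Qed.

Lemma lexpVr h : E h * E (- h) = 1.
Proof.
by rewrite lexpM lbrN lbr_self oppr0 mulr0 subrr add0r lexp_const cexp0 scale1r.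
Qed.

Lemma lexp_unit h : E h \is a GRing.unit.
Proof.
by apply/unitrP; exists (E (- h)); rewrite lexpVr -{2}[h]opprK lexpVr.
Qed.

Lemma lexpN h : E (- h) = (E h)^-1.
Proof. by apply: (mulrI (lexp_unit h)); rewrite lexpVr divrr // lexp_unit. Qed.

Lemma lexp_qcomm f h : E f * E h = q ^ lbr f h *: (E h * E f).
Proof.
rewrite !lexpM !lexpDconst [h + f]addrC [RHS]scalerA [lbr h f]lbrC.
rewrite /q /qparam -cexp_mulrz -cexpD rmorphN; congr (cexp _ *: _).
by field.
Qed.

(** The monomials with exponents 0 and [f.2] are distinct, hence linearly independent, so the sum is
    nonzero in a division algebra. *)
Lemma one_plus_lexp_unit f : f.2 != 0 -> 1 + q *: E f \is a GRing.unit.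
Proof.
move=> f0; apply: (qW_division hD); apply/eqP => e0.
pose k (v : 'rV[int]_3 * 'rV[int]_3) : R[i] := if v == 0 then 1 else
  q * cexp (f.1 - hbar / 2%:R * (\sum_(i < 3) f.2.1 0 i * f.2.2 0 i)%:~R).
have := qW_free hD (s := [:: 0; f.2]) (k := k).
rewrite !big_cons big_nil /k /= eqxx (negPf f0) scale1r addr0 -scalerA.
rewrite inE eq_sym f0 => /(_ isT) h.
have q0 : qmono eu ew 0 = 1.
  by rewrite /qmono !big1 ?mulr1 // => i _; rewrite !mxE expr0z.
move: h; rewrite q0 => /(_ e0 0).
by rewrite inE !eqxx => /(_ isT)/eqP; rewrite oner_eq0.
Qed.

Lemma lbr_neq0 f h : lbr f h != 0 -> f.2 != 0.
Proof.
apply: contraNneq => f0; rewrite /lbr f0 big1 // => i _.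
by rewrite !mxE !mul0r subrr.
Qed.

Lemma hom_sum (base : D -> D -> Prop) (I : eqType) (r : seq I) (F G : I -> D) :
  {in r, forall i, hom_graph base (F i) (G i)} ->
  hom_graph base (\sum_(i <- r) F i) (\sum_(i <- r) G i).
Proof.
elim: r => [_|i r IHr FG].
  by rewrite !big_nil -[0](scale0r 1); exact: hom_scalar.
rewrite !big_cons; apply: hom_add; first by apply: FG; rewrite mem_head.
by apply: IHr => j jr; apply: FG; rewrite inE jr orbT.
Qed.

Lemma Ad_Psi_lexp0 f h : lbr f h = 0 -> Ad_Psi hbar (E f) (E h) (E h).
Proof.
by move=> fh; apply: hom_base; left; rewrite lexp_qcomm fh expr0z scale1r.
Qed.

(** Here E(h) E(f) = q^-1 E(h + f), which cancels the q in the factor 1 + q E(f). *)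
Lemma Ad_Psi_lexp2 f h : lbr f h = 2 ->
  Ad_Psi hbar (E f) (E h) (E h + E (h + f)).
Proof.
move=> fh; apply: hom_base; right; split; first by rewrite lexp_qcomm fh.
rewrite mulrDr mulr1 -scalerAr lexpM lexpDconst scalerA lbrC fh.
rewrite /qparam -cexpD.
have -> : hbar + hbar / 2%:R * (- 2)%:~R = 0 by field.
by rewrite cexp0 scale1r.
Qed.

(** The source factors as (1 + q E(f)) E(h). The first factor commutes with E(f) and is fixed; E(h)
    is the inverse of E(-h), to which the rule for bracket 2 applies. *)
Lemma Ad_Psi_lexpN2 f h : lbr f h = - 2%:Z ->
  Ad_Psi hbar (E f) (E h + E (h + f)) (E h).
Proof.
move=> fh.
have uf : 1 + q *: E f \is a GRing.unit.
  by apply: one_plus_lexp_unit; apply: (@lbr_neq0 _ h); rewrite fh.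
have -> : E h + E (h + f) = (1 + q *: E f) * E h.
  rewrite mulrDl mul1r -scalerAl lexpM lexpDconst scalerA fh addrC [h + f]addrC.
  rewrite /q /qparam -cexpD.
  have -> : hbar + hbar / 2%:R * (- 2)%:~R = 0 by field.
  by rewrite cexp0 scale1r addrC.
(* The target is split in parallel: 1 + q E(f) times the inverse of the image of E(-h). *)
have e : E h = (1 + q *: E f) * (E (- h) * (1 + q *: E f))^-1.
  by rewrite invrM ?lexp_unit // mulrA divrr // mul1r lexpN invrK.
have eV : E h = (E (- h))^-1 by rewrite lexpN invrK.
rewrite {2}e {1}eV.
apply: hom_mul.
  apply: hom_base; left; split=> //.
  by move: (E f) => x; rewrite mulrDr mulrDl mulr1 mul1r -scalerAl -scalerAr.
apply: hom_inv; first exact: lexp_unit.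
by apply: hom_base; right; rewrite lexp_qcomm lbrN fh.
Qed.

End WeylExponentials.

(** * Integer coordinates and the finite computation *)

(* A sequence [x : seq int] of length 19 lists the coordinates of a linear form on
   [u_1..3, w_1..3, hbar/2, a_1..3/2, b_1..3/2, c_1..3/2, d_1..3/2]. *)
Notation coords := (seq int).

Definition coordsD (x y : coords) : coords := mkseq (fun i => x`_i + y`_i) 19.

Definition at_u (i : nat) (z : int) := (i, z).
Definition at_w (i : nat) (z : int) := ((3 + i)%N, z).
Definition at_h (z : int) := (6%N, z).
(** From position 7 on, halves are counted: the value 2 stands for one whole parameter. *)
Definition at_a (i : nat) (z : int) := ((7 + i)%N, z).
Definition at_b (i : nat) (z : int) := ((10 + i)%N, z).
Definition at_c (i : nat) (z : int) := ((13 + i)%N, z).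
Definition at_d (i : nat) (z : int) := ((16 + i)%N, z).

Definition coords_of (s : seq (nat * int)) : coords :=
  foldr (fun p x => coordsD (mkseq (fun i => if i == p.1 then p.2 else 0) 19) x)
    (nseq 19 0) s.

Definition coords_lbr (x y : coords) : int :=
  (x`_0 * y`_3 - x`_3 * y`_0) + (x`_1 * y`_4 - x`_4 * y`_1)
  + (x`_2 * y`_5 - x`_5 * y`_2).

(** Position 6 counts hbar/2, so the Baker-Campbell-Hausdorff correction is the integer bracket
    itself. *)
Definition coordsM (x y : coords) : coords :=
  coordsD (coordsD x y) (coords_of [:: at_h (coords_lbr x y)]).

(* [g] is the total coefficient of [lambda_0], which enters [P] directly and
   through [lambda_1] and [lambda_2]; halves are absorbed in the basis. *)
Definition coords_P (x : coords) : coords :=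
  let g := x`_3 - x`_5 + (x`_0 + x`_2 - x`_1) in
  [:: x`_0; x`_2 + x`_0; x`_1 - x`_0;
      x`_3 + x`_4 - x`_5; x`_5; x`_4;
      x`_6;
      x`_7 - 2 * x`_5; x`_8 + 2 * x`_3 - g; x`_9 - 2 * x`_3 + g;
      x`_10; x`_11 + 2 * x`_3 - 2 * x`_5 - g;
      x`_12 - 2 * x`_3 + 2 * x`_5 + g;
      x`_13 + 2 * x`_4; x`_14 - 2 * x`_4 - g; x`_15 + 2 * x`_4 + g;
      x`_16; x`_17 - g; x`_18 + g].

Definition yp_coords := [:: at_u 0 1; at_u 2 1; at_w 0 1; at_w 1 (-1); at_w 2 1].
Definition ym_coords :=
  [:: at_u 0 1; at_u 2 (-1); at_w 0 1; at_w 1 (-1); at_w 2 1].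
(* the coordinates of [- e_3 = a_3 + b_3 + c_3 + d_3] *)
Definition Ne3_coords := [:: at_a 2 2; at_b 2 2; at_c 2 2; at_d 2 2].
Definition Y1_coords :=
  coords_of ([:: at_d 0 (-2); at_c 1 (-2); at_b 2 (-2)] ++ yp_coords).
Definition Y2_coords :=
  coords_of ([:: at_d 0 (-2); at_c 1 (-2); at_b 2 (-2)]
    ++ Ne3_coords ++ ym_coords).
Definition Y3_coords :=
  coords_of ([:: at_b 0 (-2); at_a 1 (-2); at_d 2 (-2)]
    ++ Ne3_coords ++ ym_coords).
Definition Y4_coords :=
  coords_of ([:: at_b 0 (-2); at_a 1 (-2); at_d 2 (-2)] ++ yp_coords).

Definition L_coords (l a b i j : nat) : seq coords :=
  match a, b, i, j with
  | 0, 0, 0, 0 => [:: coords_of [:: at_c l 2]]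
  | 1, 1, 1, 1 => [:: coords_of [:: at_a l 2]]
  | 1, 0, 1, 0 => [:: coords_of [:: at_d l (-2); at_u l 1]]
  | 0, 1, 0, 1 => [:: coords_of [:: at_b l (-2); at_u l 1]]
  | 1, 0, 0, 1 => [:: coords_of [:: at_w l (-1)]]
  | 0, 1, 1, 0 => [:: coords_of [:: at_c l 2; at_a l 2; at_w l 1];
                      coords_of [:: at_b l (-2); at_d l (-2); at_u l 2; at_w l 1]]
  | _, _, _, _ => [::]
  end%N.

(** Both members of a pair x, x + f have the same bracket with f, so both lie in [sN]; the one whose
    shift is also present is kept. Terms with bracket other than 0, 2, -2 are dropped, and [mutable]
    rejects such lists. *)
Definition mutate (f : coords) (s : seq coords) : seq coords :=
  let s0 := [seq x <- s | coords_lbr f x == 0] in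
  let s2 := [seq x <- s | coords_lbr f x == 2] in
  let sN := [seq x <- s | coords_lbr f x == -2%:Z] in
  s0 ++ s2 ++ map (coordsD^~ f) s2 ++ [seq x <- sN | coordsD x f \in sN].

(* Whether [s] splits as required for [mutate f s] to be its image; in general
   longer strings [x, x + f, x + 2 f, ...] could interfere with the pairing. *)
Definition mutable (f : coords) (s : seq coords) : bool :=
  let s0 := [seq x <- s | coords_lbr f x == 0] in
  let s2 := [seq x <- s | coords_lbr f x == 2] in
  let sN := [seq x <- s | coords_lbr f x == -2%:Z] in
  let t := [seq x <- sN | coordsD x f \in sN] in
  perm_eq s (s0 ++ s2 ++ t ++ map (coordsD^~ f) t).

(** An index of V1 * V2 * V3 is read as three binary digits, first factor leading, which agrees by
    computation with [mxtens_unindex]. *)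
Definition dig1 (m : nat) := (m %/ 2 %/ 2)%N.
Definition dig2 (m : nat) := (m %/ 2 %% 2)%N.
Definition dig3 (m : nat) := (m %% 2)%N.

Definition L12_coords l (m n : nat) : seq coords :=
  if dig3 m == dig3 n
  then L_coords l (dig1 m) (dig2 m) (dig1 n) (dig2 n) else [::].
Definition L13_coords l (m n : nat) : seq coords :=
  if dig2 m == dig2 n
  then L_coords l (dig1 m) (dig3 m) (dig1 n) (dig3 n) else [::].
Definition L23_coords l (m n : nat) : seq coords :=
  if dig1 m == dig1 n
  then L_coords l (dig2 m) (dig3 m) (dig2 n) (dig3 n) else [::].

(** A list stands for the sum of the exponentials of its members; coefficients are multiplicities,
    so products need no collecting of terms. *)
Definition mulmx_coords (M N : nat -> nat -> seq coords) (m n : nat) :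
    seq coords :=
  flatten [seq [seq coordsM x y | x <- M m p, y <- N p n] | p <- iota 0 8].

Definition lhs_coords :=
  mulmx_coords (mulmx_coords (L23_coords 2) (L13_coords 1)) (L12_coords 0).
Definition rhs_coords :=
  mulmx_coords (mulmx_coords (L12_coords 0) (L13_coords 1)) (L23_coords 2).

Definition intertwined (x y : seq coords) : bool :=
  let x4 := mutate Y4_coords x in let x3 := mutate Y3_coords x4 in
  let y1 := mutate Y1_coords y in let y2 := mutate Y2_coords y1 in
  [&& mutable Y4_coords x, mutable Y3_coords x4,
      mutable Y1_coords y, mutable Y2_coords y1 & perm_eq (map coords_P x3) y2].

(** A closed boolean over the 64 matrix entries. The parameters occur only as formal coordinates, so
    one evaluation serves all their values. *)
Lemma intertwined_entries :
  all (fun m => all (fun n => intertwined (lhs_coords m n) (rhs_coords m n))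
    (iota 0 8)) (iota 0 8).
Proof. by vm_compute. Qed.

(** * Interpretation of coordinates as linear forms *)

Lemma ord3_ind (Q : 'I_3 -> Prop) : Q i1 -> Q i2 -> Q i3 -> forall i, Q i.
Proof.
by move=> h1 h2 h3 [[|[|[|//]]] hi]; rewrite (bool_irrelevance hi isT).
Qed.

Lemma row3P (v w : 'rV[int]_3) :
  v 0 i1 = w 0 i1 -> v 0 i2 = w 0 i2 -> v 0 i3 = w 0 i3 -> v = w.
Proof. by move=> h1 h2 h3; apply/rowP; elim/ord3_ind. Qed.

Section Interpretation.
Variables (R : realType) (hbar : R[i]) (a b c d e : 'I_3 -> R[i]).
Hypothesis hsum : forall i, a i + b i + c i + d i + e i = 0.

(** The values of the constants at positions 6 to 18. *)
Definition sym : seq R[i] :=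
  hbar / 2%:R :: [seq f i / 2%:R | f <- [:: a; b; c; d], i <- [:: i1; i2; i3]].

Definition interp (x : coords) : lform R :=
  (\sum_(j < 13) sym`_j * (x`_(6 + j))%:~R,
   (\row_i x`_i, \row_i x`_(3 + i))).

(** The lengths of [x] and [y] are arbitrary: missing positions read as 0, and [interp] reads only
    positions below 19. *)
Lemma interpD x y : interp (coordsD x y) = interp x + interp y.
Proof.
have nth_coordsD i : (i < 19)%N -> (coordsD x y)`_i = x`_i + y`_i.
  exact: nth_mkseq.
rewrite /interp; set z := coordsD x y in nth_coordsD *; congr (_, (_, _)).
- rewrite -big_split; apply: eq_bigr => j _.
  by rewrite nth_coordsD ?rmorphD ?mulrDr // (ltn_add2l 6 _ 13).
- by apply/rowP => i; rewrite !mxE nth_coordsD // (ltn_trans (ltn_ord i)).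
- apply/rowP => i; rewrite !mxE nth_coordsD //.
  by rewrite (leq_trans (_ : _ < 3 + 3)%N) // ltn_add2l.
Qed.

Lemma lbr_interp x y : lbr (interp x) (interp y) = coords_lbr x y.
Proof.
by rewrite /lbr !big_ord_recl big_ord0 !mxE /coords_lbr /= addr0 addrA.
Qed.

(** Eliminates [e], which has no coordinates of its own. *)
Let eE i : e i = - (a i + b i + c i + d i).
Proof. by apply/eqP; rewrite -addr_eq0 addrC hsum. Qed.

Ltac interp_concrete :=
  apply: injective_projections => /=; last apply: injective_projections => /=;
  [ rewrite !big_ord_recl big_ord0 /=; by field
  | by apply: row3P; rewrite !mxE
  | by apply: row3P; rewrite !mxE ].

Lemma interp_hbar z :
  interp (coords_of [:: at_h z]) = lconst (hbar / 2%:R * z%:~R).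
Proof. interp_concrete. Qed.

Lemma interp_Y1 : interp Y1_coords = lconst (- d i1 - c i2 - b i3)
    + (lu R i1 + lu R i3 + lw R i1 - lw R i2 + lw R i3).
Proof.
interp_concrete.
Qed.

Lemma interp_Y2 : interp Y2_coords = lconst (- d i1 - c i2 - b i3 - e i3)
    + (lu R i1 - lu R i3 + lw R i1 - lw R i2 + lw R i3).
Proof. rewrite eE; interp_concrete. Qed.

Lemma interp_Y3 : interp Y3_coords = lconst (- b i1 - a i2 - d i3 - e i3)
    + (lu R i1 - lu R i3 + lw R i1 - lw R i2 + lw R i3).
Proof. rewrite eE; interp_concrete. Qed.

Lemma interp_Y4 : interp Y4_coords = lconst (- b i1 - a i2 - d i3)
    + (lu R i1 + lu R i3 + lw R i1 - lw R i2 + lw R i3).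
Proof. interp_concrete. Qed.

Lemma lbrDl (f g h : lform R) : lbr (f + g) h = lbr f h + lbr g h.
Proof.
by rewrite /lbr -big_split; apply: eq_bigr => i _ /=; rewrite !mxE; ring.
Qed.

Lemma lbrNl (f h : lform R) : lbr (- f) h = - lbr f h.
Proof. by rewrite /lbr -sumrN; apply: eq_bigr => i _; rewrite !mxE; ring. Qed.

Lemma lbr_lu i (h : lform R) : lbr (lu R i) h = h.2.2 0 i.
Proof.
rewrite /lbr (bigD1 i) //= big1 ?addr0 => [|j ji]; rewrite !mxE ?eqxx /=.
  by rewrite mul1r mul0r subr0.
by rewrite (negPf ji) !mul0r subrr.
Qed.

Lemma lbr_lw i (h : lform R) : lbr (lw R i) h = - h.2.1 0 i.
Proof.
rewrite /lbr (bigD1 i) //= big1 ?addr0 => [|j ji]; rewrite !mxE ?eqxx /=.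
  by rewrite mul1r mul0r sub0r.
by rewrite (negPf ji) !mul0r subrr.
Qed.

Lemma lbr_lconst k (h : lform R) : lbr (lconst k) h = 0.
Proof. by rewrite /lbr big1 // => i _; rewrite !mxE !mul0r subrr. Qed.

Lemma lform_mulrz (f : lform R) z :
  f *~ z = (f.1 *~ z, (f.2.1 *~ z, f.2.2 *~ z)).
Proof.
have nat_case n : f *+ n = (f.1 *+ n, (f.2.1 *+ n, f.2.2 *+ n)).
  by elim: n => [|n IHn]; rewrite ?mulr0n // !mulrS IHn.
by case: z => n; rewrite ?NegzE ?mulrNz -!pmulrn nat_case.
Qed.

Lemma row_mulrz n (v : 'rV[int]_n) z i : (v *~ z) 0 i = v 0 i * z.
Proof.
have nat_case k : (v *+ k) 0 i = v 0 i * k%:Z.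
  rewrite -natz mulr_natr.
  by elim: k => [|k IHk]; rewrite ?mulr0n ?mxE // !mulrS mxE IHk.
by case: z => k; rewrite ?NegzE ?mulrNz -!pmulrn ?mxE nat_case ?mulrN.
Qed.

Lemma interp_P x : Ad_P_lform a b c e (interp x) = interp (coords_P x).
Proof.
rewrite /Ad_P_lform /Ad_exp_quad /Ad_exp_lin !big_cons !big_nil /=.
(* Brackets with u_i and w_i read off single coordinates, so the action of P becomes explicit in the
   coordinates of [x]. *)
rewrite !(lbrDl, lbrNl, lbr_lu, lbr_lw) /=.
rewrite !mxE /= tpermL tpermR tpermD //= !lform_mulrz.
apply: injective_projections => /=; last apply: injective_projections => /=.
- by rewrite !big_ord_recl !big_ord0 /= !eE; field.
- by apply: row3P; rewrite !(row_mulrz, mxE) ?tpermL ?tpermR ?tpermD //=; ring.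
- by apply: row3P; rewrite !(row_mulrz, mxE) ?tpermL ?tpermR ?tpermD //=; ring.
Qed.
Section LEntries.
Variable l : 'I_3.

Lemma interp_r : interp (coords_of [:: at_c l 2]) = lconst (c l).
Proof. elim/ord3_ind: l; interp_concrete. Qed.

Lemma interp_s : interp (coords_of [:: at_a l 2]) = lconst (a l).
Proof. elim/ord3_ind: l; interp_concrete. Qed.

Lemma interp_wX :
  interp (coords_of [:: at_d l (-2); at_u l 1]) = lu R l + lconst (- d l).
Proof. elim/ord3_ind: l; interp_concrete. Qed.

Lemma interp_tX :
  interp (coords_of [:: at_b l (-2); at_u l 1]) = lu R l + lconst (- b l).
Proof. elim/ord3_ind: l; interp_concrete. Qed.

Lemma interp_Z : interp (coords_of [:: at_w l (-1)]) = - lw R l.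
Proof. elim/ord3_ind: l; interp_concrete. Qed.

Lemma interp_rsZV :
  interp (coords_of [:: at_c l 2; at_a l 2; at_w l 1]) =
  lw R l + lconst (c l + a l).
Proof. elim/ord3_ind: l; interp_concrete. Qed.

Lemma interp_twXZVX :
  interp (coords_of [:: at_b l (-2); at_d l (-2); at_u l 2; at_w l 1]) =
  lu R l + lw R l + lu R l + lconst (- b l - d l).
Proof. elim/ord3_ind: l; interp_concrete. Qed.

End LEntries.

End Interpretation.

(** * Matrix entries of the L-operators *)

(** Collapses the sum over matrix units; [k] will be the Kronecker delta on the tensor factor where
    the operator is the identity. *)
Lemma sum_delta4 (A : nzRingType) (T : finType) (F : T -> T -> T -> T -> A)
    (x y z t : T) (k : bool) :
  \sum_a \sum_b \sum_i \sum_j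
    F a b i j * ([&& x == a, z == i, y == b, t == j & k])%:R =
  F x y z t * k%:R.
Proof.
rewrite (bigD1 x) //= [X in _ + X]big1 ?addr0 => [|a ax]; last first.
  rewrite big1 // => b _; rewrite big1 // => i _; rewrite big1 // => j _.
  by rewrite eq_sym (negPf ax) mulr0.
rewrite (bigD1 y) //= [X in _ + X]big1 ?addr0 => [|b bx]; last first.
  rewrite big1 // => i _; rewrite big1 // => j _.
  by rewrite [y == b]eq_sym (negPf bx) !andbF mulr0.
rewrite (bigD1 z) //= [X in _ + X]big1 ?addr0 => [|i ix]; last first.
  by rewrite big1 // => j _; rewrite [z == i]eq_sym (negPf ix) !andbF mulr0.
rewrite (bigD1 t) //= [X in _ + X]big1 ?addr0 => [|j jx]; last first.
  by rewrite [t == j]eq_sym (negPf jx) !andbF mulr0.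
by rewrite !eqxx.
Qed.

Section MatrixEntries.
Variables (K : comNzRingType) (A : unitAlgType K).
Variable L : 'I_2 -> 'I_2 -> 'I_2 -> 'I_2 -> A.
Implicit Types m n : 'I_(2 * 2 * 2).

Definition idx1 m : 'I_2 := (mxtens_unindex (mxtens_unindex m).1).1.
Definition idx2 m : 'I_2 := (mxtens_unindex (mxtens_unindex m).1).2.
Definition idx3 m : 'I_2 := (mxtens_unindex m).2.

Lemma L12E m n : L12 L m n =
  L (idx1 m) (idx2 m) (idx1 n) (idx2 n) * (idx3 m == idx3 n)%:R.
Proof.
rewrite -sum_delta4 /L12 summxE; apply: eq_bigr => a _.
rewrite summxE; apply: eq_bigr => b _; rewrite summxE; apply: eq_bigr => i _.
rewrite summxE; apply: eq_bigr => j _; rewrite !mxE -!natrM !mulnb.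
by rewrite !andbA.
Qed.

Lemma L13E m n : L13 L m n =
  L (idx1 m) (idx3 m) (idx1 n) (idx3 n) * (idx2 m == idx2 n)%:R.
Proof.
rewrite -sum_delta4 /L13 summxE; apply: eq_bigr => a _.
rewrite summxE; apply: eq_bigr => b _; rewrite summxE; apply: eq_bigr => i _.
rewrite summxE; apply: eq_bigr => j _; rewrite !mxE -!natrM !mulnb.
congr (_ * (nat_of_bool _)%:R); rewrite -!andbA; do !bool_congr.
Qed.

Lemma L23E m n : L23 L m n =
  L (idx2 m) (idx3 m) (idx2 n) (idx3 n) * (idx1 m == idx1 n)%:R.
Proof.
rewrite -sum_delta4 /L23 summxE; apply: eq_bigr => a _.
rewrite summxE; apply: eq_bigr => b _; rewrite summxE; apply: eq_bigr => i _.
rewrite summxE; apply: eq_bigr => j _; rewrite !mxE -!natrM !mulnb.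
congr (_ * (nat_of_bool _)%:R); rewrite -!andbA; do !bool_congr.
Qed.

End MatrixEntries.

(** * Sums of exponentials and the action of R on them *)

Section SumsOfExponentials.
Variables (R : realType) (hbar : R[i]) (D : unitAlgType R[i]).
Variables (eu ew : 'I_3 -> D).
Hypothesis hD : is_qWeyl_fraction_field hbar eu ew.
Variables (a b c d e : 'I_3 -> R[i]).
Hypothesis hsum : forall i, a i + b i + c i + d i + e i = 0.

Let E := lexp hbar eu ew.
Let I := interp hbar a b c d.

Definition sumE (s : seq coords) : D := \sum_(x <- s) E (I x).

Lemma lexp_coordsM x y : E (I (coordsM x y)) = E (I x) * E (I y).
Proof. by rewrite /I /coordsM 2!interpD interp_hbar (lexpM hD) lbr_interp. Qed.

Lemma sumEM s t : sumE s * sumE t = sumE [seq coordsM x y | x <- s, y <- t].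
Proof.
rewrite /sumE big_allpairs_dep mulr_suml; apply: eq_bigr => x _.
by rewrite mulr_sumr; apply: eq_bigr => y _; rewrite lexp_coordsM.
Qed.

Lemma sumE_mutate f s : mutable f s ->
  Ad_Psi hbar (E (I f)) (sumE s) (sumE (mutate f s)).
Proof.
rewrite /sumE => /(perm_big _) ->; rewrite /mutate.
have lbrI x : lbr (I f) (I x) = coords_lbr f x by exact: lbr_interp.
rewrite !big_cat !big_map /=; apply: hom_add.
  apply: hom_sum => x; rewrite mem_filter => /andP[/eqP fx _].
  by apply: (Ad_Psi_lexp0 hD); rewrite lbrI.
(* Regrouping matches each E(x) of bracket 2 with E(x) + E(x + f), and each pair of bracket -2 with
   its first member. *)
rewrite [X in hom_graph _ _ X]addrA -!big_split /=.
apply: hom_add; apply: hom_sum => x; rewrite !mem_filter.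
  case/andP=> /eqP fx _; rewrite /I interpD.
  by apply: (Ad_Psi_lexp2 hD); rewrite lbrI.
case/andP=> _ /andP[/eqP fx _]; rewrite /I interpD.
by apply: (Ad_Psi_lexpN2 hD); rewrite lbrI.
Qed.


Lemma sumE_P s :
  Ad_lift hbar eu ew (Ad_P_lform a b c e) (sumE s) (sumE (map coords_P s)).
Proof.
rewrite /sumE big_map; apply: hom_sum => x _; apply: hom_base.
by exists (I x); rewrite interp_P.
Qed.

Let L (l : 'I_3) := Lent (cexp (c l)) (cexp (a l)) (cexp (- b l)) (cexp (- d l))
  (E (lu R l)) (E (- lw R l)).

Lemma Lent_sumE l x y i j : L l x y i j = sumE (L_coords l x y i j).
Proof.
have E1 z : sumE [:: z] = E (I z) by exact: big_seq1.
case: x => [[|[|//]] hx]; case: y => [[|[|//]] hy];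
  case: i => [[|[|//]] hi]; case: j => [[|[|//]] hj];
  rewrite /L /Lent /L_coords /=;
  rewrite ?E1 /I /sumE ?big_nil /E //.
- by rewrite interp_r lexp_const.
- by rewrite interp_tX lexpDconst.
- rewrite !big_cons big_nil addr0 /I interp_rsZV interp_twXZVX.
  rewrite -(lexpN hD) opprK !lexpDconst -!cexpD; congr (_ + _ *: _).
  (* In e^u e^w e^u the two corrections hbar/2 and -hbar/2 cancel, so no power of q remains. *)
  rewrite !(lexpM hD) !(lbrDl, lbr_lconst, lbr_lu, lbr_lw) !mxE !eqxx /= addr0.
  rewrite lexpDconst addrAC lexpDconst scalerA -cexpD add0r.
  by rewrite rmorphN mulrN addNr cexp0 scale1r.
- by rewrite interp_Z.
- by rewrite interp_wX lexpDconst.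
- by rewrite interp_s lexp_const.
Qed.

Lemma mulmx_coordsE (M N : 'M[D]_(2 * 2 * 2)) (cM cN : nat -> nat -> seq coords) :
  (forall m n, M m n = sumE (cM m n)) -> (forall m n, N m n = sumE (cN m n)) ->
  forall m n, (M *m N) m n = sumE (mulmx_coords cM cN m n).
Proof.
move=> hM hN m n.
(* The bound 2 * 2 * 2 is replaced by the convertible 8, to match [iota 0 8]. *)
have -> : (M *m N) m n = \sum_(p < 8) sumE (cM m p) * sumE (cN p n).
  by rewrite mxE; apply: eq_bigr => p _; rewrite hM hN.
rewrite -(big_mkord xpredT (fun p => sumE (cM m p) * sumE (cN p n))).
rewrite [RHS]big_flatten big_map; apply: eq_bigr => p _; exact: sumEM.
Qed.

Lemma sumE_if (k : bool) s : sumE s * k%:R = sumE (if k then s else [::]).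
Proof. by case: k; rewrite ?mulr1 // mulr0 /sumE big_nil. Qed.

Lemma L12_coordsE l m n : L12 (L l) m n = sumE (L12_coords l m n).
Proof. by rewrite L12E Lent_sumE sumE_if. Qed.

Lemma L13_coordsE l m n : L13 (L l) m n = sumE (L13_coords l m n).
Proof. by rewrite L13E Lent_sumE sumE_if. Qed.

Lemma L23_coordsE l m n : L23 (L l) m n = sumE (L23_coords l m n).
Proof. by rewrite L23E Lent_sumE sumE_if. Qed.

Lemma Ad_R_intertwined s t :
  intertwined s t -> Ad_R hbar eu ew a b c d e (sumE s) (sumE t).
Proof.
case/and5P => m4 m3 m1 m2 st.
(* The first three witnesses follow [s] through Psi(Y4), Psi(Y3) and P. The last follows [t] through
   Psi(Y1), since inverse factors act by the converse relation. *)
exists (sumE (mutate Y4_coords s)).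
exists (sumE (mutate Y3_coords (mutate Y4_coords s))).
exists (sumE (map coords_P (mutate Y3_coords (mutate Y4_coords s)))).
exists (sumE (mutate Y1_coords t)).
rewrite /Y1 /Y2 /Y3 /Y4 -(interp_Y1 hbar a b c d) -(interp_Y2 hbar hsum).
rewrite -(interp_Y3 hbar hsum) -(interp_Y4 hbar a b c d).
split; try exact: sumE_mutate; first exact: sumE_P.
have -> : sumE (map coords_P (mutate Y3_coords (mutate Y4_coords s))) =
    sumE (mutate Y2_coords (mutate Y1_coords t)) by exact: perm_big.
exact: sumE_mutate.
Qed.

End SumsOfExponentials.

(** * The intertwining relation, entry by entry *)

Theorem theorem7p1 (R : realType) (hbar : R[i])
    (hq : forall k : nat, (0 < k)%N -> cexp hbar ^+ k != 1)
    (D : unitAlgType R[i]) (eu ew : 'I_3 -> D)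
    (hD : is_qWeyl_fraction_field hbar eu ew)
    (a b c d e : 'I_3 -> R[i])
    (hsum : forall i : 'I_3, a i + b i + c i + d i + e i = 0) :
  let L := fun l : 'I_3 =>
    Lent (cexp (c l)) (cexp (a l)) (cexp (- b l)) (cexp (- d l))
         (lexp hbar eu ew (lu R l)) (lexp hbar eu ew (- lw R l)) in
  let L124 := L12 (L i1) in
  let L135 := L13 (L i2) in
  let L236 := L23 (L i3) in
  forall m n : 'I_(2 * 2 * 2),
    Ad_R hbar eu ew a b c d e
      ((L236 *m L135 *m L124) m n) ((L124 *m L135 *m L236) m n).
Proof.
move=> L L124 L135 L236 m n.
have e12 := L12_coordsE hD a b c d i1; have e13 := L13_coordsE hD a b c d i2.
have e23 := L23_coordsE hD a b c d i3.
rewrite (mulmx_coordsE hD (mulmx_coordsE hD e23 e13) e12).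
rewrite (mulmx_coordsE hD (mulmx_coordsE hD e12 e13) e23).
apply: (Ad_R_intertwined hD hsum).
by move/allP: intertwined_entries => /(_ m) /[!mem_iota] /(_ (ltn_ord m))
  /allP /(_ n) /[!mem_iota] /(_ (ltn_ord n)).
Qed.
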